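(* Let $\mathcal{H}\neq\{0\}$ be a separable complex Hilbert space and let $\mathcal{P}(\mathcal{H})$ be the projective Hilbert space, regarded as the set of one-dimensional orthogonal projections on $\mathcal{H}$ with its natural topology $\mathcal{T}$. Then the $\sigma$-algebra $\Xi=\Xi(\mathcal{T})$ of the Borel sets of $\mathcal{P}(\mathcal{H})$ and the $\sigma$-algebra $\Sigma$ generated by the transition-probability functions $h_Q$, $Q\in\mathcal{P}(\mathcal{H})$, are equal.
   Context: The natural topology $\mathcal{T}$ on $\mathcal{P}(\mathcal{H})$ is the coarsest topology such that all functions $h_Q:\mathcal{P}(\mathcal{H})\to\mathbb{R}$, $h_Q(P):=\mathrm{tr}\,PQ$, with $Q\in\mathcal{P}(\mathcal{H})$, are continuous; it coincides with the topology of the operator-norm metric $\rho_n(P,Q)=\|P-Q\|$. $\Xi(\mathcal{T})$ is the smallest $\sigma$-algebra containing all $\mathcal{T}$-open sets. $\Sigma$ is the smallest $\sigma$-algebra on $\mathcal{P}(\mathcal{H})$ such that all the functions $h_Q$, $Q\in\mathcal{P}(\mathcal{H})$, are measurable (with respect to the Borel $\sigma$-algebra of $\mathbb{R}$). *)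

(* Defs.v *)
From HB Require Import structures.
From mathcomp Require Import all_boot all_order all_algebra.
From mathcomp Require Import sesquilinear.
From mathcomp Require Import all_classical all_reals all_analysis.
From mathcomp Require summability.
From mathcomp Require Import complex.

Set Implicit Arguments.
Unset Strict Implicit.
Unset Printing Implicit Defensive.
Import Order.TTheory GRing.Theory Num.Theory.
Import numFieldNormedType.Exports.
Local Open Scope classical_set_scope.
Local Open Scope ring_scope.

Definition separable (T : topologicalType) : Prop :=
  exists2 D : set T, countable D & dense D.

Section operators.
Context {C : numClosedFieldType} {H : normedModType C}.

Definition linear_span (B : set H) : set H :=
  [set x | exists (s : seq H) (c : H -> C),
     [set` s] `<=` B /\ x = \sum_(e <- s) c e *: e].

(* [{dot H for conj}] is linear in its first argument and conjugate-linear in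
   its second one. *)
Variable ip : {dot H for @Num.conj C}.

Definition orthonormal_basis (B : set H) : Prop :=
  (forall e f, B e -> B f -> ip e f = (e == f)%:R) /\
  closure (linear_span B) = setT.

(* The sum over a basis is the limit of the net of its finite partial sums, so
   finite and infinite dimension are treated alike. *)
Definition is_trace (A : H -> H) (t : C) : Prop :=
  forall B : set H, orthonormal_basis B ->
    summability.partial_sum (fun e : B => ip (A (val e)) (val e))
      @ summability.totally --> t.

(* Default value 0 if [A] has no trace. *)
Definition tr (A : H -> H) : C := xget 0 [set t | is_trace A t].

(* Continuity of an orthogonal projection is not required: it follows from the
   other conditions. *)
Definition orthogonal_projection (P : H -> H) : Prop :=
  [/\ linear P, P \o P = P & forall x y, ip (P x) y = ip x (P y)].

Definition one_dimensional (V : set H) : Prop :=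
  exists2 v : H, v != 0 & V = [set c *: v | c in [set: C]].

Record projective := Projective {
  proj_op :> H -> H ;
  proj_orthogonal : orthogonal_projection proj_op ;
  proj_dim1 : one_dimensional (range proj_op) }.

HB.instance Definition _ := gen_eqMixin projective.
HB.instance Definition _ := gen_choiceMixin projective.

End operators.

Section transition_probability.
Context {R : realType} {H : completeNormedModType R[i]}.
Variable ip : {dot H for @Num.conj R[i]}.

(* [tr ip (P \o Q)] is an element of [R[i]] with zero imaginary part; [Re] only
   moves it to [R]. *)
Definition transition_prob (Q P : projective ip) : R := complex.Re (tr ip (P \o Q)).

Definition natural_topology : topologicalType :=
  sup_topology (fun Q : projective ip =>
    Topological.on (initial_topology (transition_prob Q))).

Definition borel_sigma_algebra : set (set (projective ip)) :=
  <<s @open natural_topology >>.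

Definition transition_sigma_algebra : set (set (projective ip)) :=
  <<s \bigcup_(Q : projective ip)
        preimage_set_system setT (transition_prob Q) (@measurable _ R) >>.

End transition_probability.

Arguments natural_topology {R H} ip.
Arguments borel_sigma_algebra {R H} ip _.
Arguments transition_sigma_algebra {R H} ip _.

(* Main.v *)
(** If [q] and [q'] are unit vectors spanning [Q] and [Q'], then Parseval's
    identity gives [tr (P Q) = |<p, q>|^2], so that [h_Q] and [h_Q'] differ
    uniformly by at most [2 * |q - q'|]. As [H] is separable, every [h_Q] is
    therefore a uniform limit of functions from one countable family [h_Q'],
    and the preimages under this family of the rational balls of [R] form a
    countable subbase of the natural topology: every open set is a countable
    union of finite intersections of sets of the sigma-algebra generated by the
    [h_Q]. *)

Require Import Defs.
From mathcomp Require Import all_boot all_order all_algebra.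
From mathcomp Require Import sesquilinear.
From mathcomp Require Import all_classical all_reals all_analysis.
From mathcomp Require Import finmap measurable_realfun complex ring lra.

Set Implicit Arguments.
Unset Strict Implicit.
Unset Printing Implicit Defensive.
Import Order.TTheory GRing.Theory Num.Theory.
Import numFieldNormedType.Exports.
Local Open Scope classical_set_scope.
Local Open Scope ring_scope.

(** * Sigma-algebras and topologies generated by real functions *)

Lemma sigma_algebra_countable_bigcup (T I : Type) (S : set (set T)) (D : set I)
    (F : I -> set T) :
  sigma_algebra setT S -> countable D -> (forall i, D i -> S (F i)) ->
  S (\bigcup_(i in D) F i).
Proof.
move=> [S0 _ SU] /pfcard_geP[->|[f]] SF; first by rewrite bigcup_set0.
have <- : f @` setT = D.
  by apply/seteqP; split=> [_ [n _ <-]|i /(@surj _ _ _ _ f)//]; apply: funS.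
by rewrite bigcup_image; apply: SU => n; apply/SF/funS.
Qed.

Lemma sigma_algebra_countable_bigcap (T I : Type) (S : set (set T)) (D : set I)
    (F : I -> set T) :
  sigma_algebra setT S -> countable D -> (forall i, D i -> S (F i)) ->
  S (\bigcap_(i in D) F i).
Proof.
move=> SS cD SF; have [_ SC _] := SS.
rewrite -[X in S X]setCK setC_bigcap -setTD; apply: (SC).
apply: sigma_algebra_countable_bigcup => // i Di.
by rewrite -setTD; apply/SC/SF.
Qed.

Lemma open_sup_initial_topology (T : choiceType) (I : Type)
    (Y : topologicalType) (h : I -> T -> Y) (i : I) (V : set Y) :
  open V ->
  @open (sup_topology (fun i => Topological.on (initial_topology (h i))))
    (h i @^-1` V).
Proof.
move=> oV; exists [set h i @^-1` V]; last by rewrite bigcup_set1.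
move=> _ ->; apply: (@finI_from1 _ _ (sup_subbase _) id).
by exists i => //; exists V.
Qed.

(** Uniformity of the approximation lets one index [j] in [G] replace [i] at a point and at all its
    neighbours simultaneously. *)
Lemma sigma_algebra_sup_initial_topology (R : realType) (T I : choiceType)
    (h : I -> T -> R) (G : set I) :
  countable G ->
  (forall (i : I) (e : R), 0 < e ->
    exists2 j, G j & forall x, `|h i x - h j x| < e) ->
  <<s @open (sup_topology
        (fun i => Topological.on (initial_topology (h i)))) >> =
  <<s \bigcup_i preimage_set_system setT (h i) (@measurable _ R) >>.
Proof.
move=> cG denseG; set S := <<s \bigcup_i _ >>.
have SS : sigma_algebra setT S by exact: smallest_sigma_algebra.
apply/seteqP; split; last first.
  apply: smallest_sub; first exact: smallest_sigma_algebra.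
  move=> _ [i _ [V mV <-]].
  (* Open intervals generate the Borel sets of [R], and the sets with preimage under [h i] in the
     left-hand sigma-algebra form a sigma-algebra. *)
  have := mV; rewrite [measurable](RGenOpens.measurableE R).
  move: V {mV}; apply: smallest_sub.
    exact/sigma_algebra_image/smallest_sigma_algebra.
  move=> _ [a [b ->]]; rewrite /image_set_system /= setTI.
  apply: sub_sigma_algebra; apply: open_sup_initial_topology.
  exact: interval_open.
apply: smallest_sub => // U [/= B finB BU].
pose w (k : I * (rat * rat)) := h k.1 @^-1` ball (ratr k.2.1 : R) (ratr k.2.2).
pose W := [set w k | k in G `*` setT].
have cW : countable W.
  by apply: (card_le_trans (card_image_le _ _)); exact: countableX.
have SW A : W A -> S A.
  move=> [k [Gk _] <-]; apply: sub_sigma_algebra; exists k.1 => //.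
  exists (ball (ratr k.2.1 : R) (ratr k.2.2)); last by rewrite setTI.
  by apply: open_measurable; exact: ball_open.
(* The neighbourhood filter of [x] in the topology with subbase [W]; it will be shown to contain
   every open [U] around [x]. *)
pose near_ x := filter_from [set A | finI_from W id A /\ A x] id.
have near_filter x : Filter (near_ x).
  apply: filter_from_filter.
    exists setT; split=> //; exists fset0 => //.
    by rewrite set_fset0 bigcap_set0.
  move=> A A' [finA Ax] [finA' A'x]; exists (A `&` A') => //.
  by split=> //; exact: finI_fromI.
have near_sub x i V : open V -> V (h i x) -> near_ x (h i @^-1` V).
  move=> oV Vx; have /nbhs_ballP[e /= e0 eV] : nbhs (h i x) V.
    exact: open_nbhs_nbhs.
  (* From [h i x] to [h i y] the path goes through [h j x], [q] and [h j y]: the errors total less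
     than [3 * (e / 8) + t < e], while [t > e / 4] keeps [x] in the ball. *)
  have [|j Gj hij] := denseG i (e / 8); first by rewrite divr_gt0.
  have [|q] := @rat_in_itvoo R (h j x - e / 8) (h j x + e / 8); first by lra.
  have [|t] := @rat_in_itvoo R (e / 4) (e / 2); first by lra.
  rewrite !in_itv /= => /andP[t1 t2] /andP[q1 q2].
  exists (w (j, (q, t))).
    split; first by apply: (@finI_from1 _ _ W id); exists (j, (q, t)).
    rewrite /w /= /ball /=; have := hij x; rewrite !ltr_norml; lra.
  move=> y; rewrite /w /= /ball /= => qy; apply: eV; rewrite /ball /=.
  move: (hij x) (hij y) qy; rewrite !ltr_norml; lra.
have near_U x : U x -> near_ x U.
  rewrite -BU => -[A BA Ax].
  apply: (@filterS _ _ _ A) => [y Ay|]; first by exists A.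
  have [D DW DA] := finB _ BA; rewrite -DA; apply: filter_bigI => A' DA'.
  have /DW/set_mem[i _ [V oV VA']] := DA'; rewrite -VA'.
  apply: near_sub => //; move: Ax; rewrite -DA => /(_ _ DA').
  by rewrite -VA'.
(* This union is countable, since [W] has only countably many finite intersections. *)
have -> : U = \bigcup_(A in [set A | finI_from W id A /\ A `<=` U]) A.
  apply/seteqP; split=> [x /near_U[A [finA Ax] AU]|x [A [_ AU] /AU//]].
  by exists A.
apply: sigma_algebra_countable_bigcup => //.
  apply: sub_countable (finI_from_countable id cW).
  by apply: subset_card_le => A [].
move=> A [[D DW <-] _]; apply: sigma_algebra_countable_bigcap => //.
by move=> A' /DW/set_mem; exact: SW.
Qed.

(* Orthonormal expansions and traces of rank-one operators *)
#[local] Existing Instance summability.totally_filter.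

Section inner_product.
Context {C : numClosedFieldType} {H : normedModType C}.
Variable ip : {dot H for @Num.conj C}.
Hypothesis ip_norm : forall x : H, ip x x = `|x| ^+ 2.

Lemma ip_conj x y : ip y x = (ip x y)^*%R.
Proof. by rewrite hermC expr0 mul1r. Qed.

(** Cauchy-Schwarz, from Pythagoras applied to [x = u + a *: y] with [u] orthogonal to [y]. *)
Lemma norm_ip_le x y : `|ip x y| <= `|x| * `|y|.
Proof.
have [->|y0] := eqVneq y 0; first by rewrite linear0r !normr0 mulr0.
have ny0 : ip y y != 0 by rewrite ip_norm expf_neq0 ?normr_eq0.
pose a := ip x y / ip y y; pose u := x - a *: y.
have uy : ip u y = 0 by rewrite linearBl linearZl_LR /= divfK ?subrr.
have : ip x x = ip u u + `|a| ^+ 2 * ip y y.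
  rewrite -{1 2}[x](subrK (a *: y)) -/u hnormDd; last first.
    by rewrite linearZr_LR /= uy mulr0.
  by congr (_ + _); exact: dnormZ.
move=> xx; rewrite -ler_sqr ?nnegrE ?mulr_ge0 //.
rewrite exprMn -!ip_norm xx mulrDl normrM normfV !ip_norm normrX normr_id.
rewrite ip_norm in ny0.
suff -> : (`|ip x y| / `|y| ^+ 2) ^+ 2 * `|y| ^+ 2 * `|y| ^+ 2 = `|ip x y| ^+ 2.
  by rewrite lerDr mulr_ge0 ?exprn_ge0.
by field; rewrite normr_eq0.
Qed.

(** For an orthonormal list [s] without repetitions, the orthogonal projection of [x] onto the span
    of [s]. *)
Definition partial_expansion (s : seq H) (x : H) : H :=
  \sum_(e <- s) ip x e *: e.

Section finite.
Variables (B : set H) (B_orth : forall e f, B e -> B f -> ip e f = (e == f)%:R).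
Variables (s : seq H) (sB : [set` s] `<=` B) (s_uniq : uniq s).

Lemma ip_partial_expansion x f : f \in s ->
  ip (partial_expansion s x) f = ip x f.
Proof.
move=> fs; rewrite linear_sumlz (bigD1_seq f) //= big1_seq => [|e /andP[ef es]].
  by rewrite linearZl_LR /= (B_orth (sB fs) (sB fs)) eqxx mulr1 addr0.
by rewrite linearZl_LR /= (B_orth (sB es) (sB fs)) (negbTE ef) mulr0.
Qed.

Lemma ip_sub_partial_expansion x (t : seq H) (c : H -> C) :
  {subset t <= s} ->
  ip (x - partial_expansion s x) (\sum_(e <- t) c e *: e) = 0.
Proof.
move=> ts; rewrite linear_sumr big1_seq // => e /= /ts es.
by rewrite linearZr_LR /= linearBl /= ip_partial_expansion // subrr mulr0.
Qed.

Lemma norm_sub_partial_expansion x : `|x - partial_expansion s x| <= `|x|.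
Proof.
have xs : ip (x - partial_expansion s x) (partial_expansion s x) = 0.
  exact: ip_sub_partial_expansion.
rewrite -ler_sqr ?nnegrE // -!ip_norm.
have := hnormDd xs; rewrite subrK => ->.
by rewrite lerDl dnorm_ge0.
Qed.

(** The difference of the two sides lies in the span of [s] and is orthogonal to it, hence to
    itself. *)
Lemma partial_expansion_id (t : seq H) (c : H -> C) : {subset t <= s} ->
  partial_expansion s (\sum_(e <- t) c e *: e) = \sum_(e <- t) c e *: e.
Proof.
move=> ts; set y := \sum_(e <- t) _.
apply/esym/eqP; rewrite -subr_eq0 -(dnorm_eq0 ip) linearBr /=.
by rewrite !ip_sub_partial_expansion // subrr.
Qed.

End finite.

Lemma partial_expansionB s x y :
  partial_expansion s (x - y) = partial_expansion s x - partial_expansion s y.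
Proof.
rewrite /partial_expansion -sumrB; apply: eq_bigr => e _.
by rewrite linearBl scalerBl.
Qed.

(** The partial sum over [A] is the inner product of [q] with the expansion of [p] along [A]; by
    Cauchy-Schwarz it suffices that these expansions tend to [p], which follows from density of the
    span. *)
Lemma parseval (B : set H) (p q : H) : orthonormal_basis ip B ->
  summability.partial_sum (fun e : B => ip p (val e) * ip (val e) q)
    @ summability.totally --> ip p q.
Proof.
move=> [Borth Bspan]; apply/cvgrPdist_lt => e e0.
(* Adding 1 keeps the divisor positive when [q = 0]. *)
have q0 : 0 < `|q| + 1 by rewrite ltr_wpDl.
have [y [py [t [c [tB yE]]]]] :
    exists y, `|p - y| < e / (`|q| + 1) /\ linear_span B y.
  have : closure (linear_span B) p by rewrite Bspan.
  move=> /(_ (ball p (e / (`|q| + 1)))); case=> [|y [By]].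
    by apply: nbhsx_ballx; rewrite divr_gt0.
  by rewrite -ball_normE /= => py; exists y.
have [A0 A0t] :
    exists A0 : {fset B}, {subset t <= [seq val x | x <- enum_fset A0]}.
  have [u ut] : exists u : seq B, t = [seq val x | x <- u].
    elim: t tB {yE} => [|x t IH] tB; first by exists [::].
    have [|u ->] := IH; first by move=> z zt; apply: tB; rewrite /= inE zt orbT.
    have xB : x \in B by apply/mem_set/tB; rewrite /= inE eqxx.
    by exists (SigSub xB :: u).
  exists [fset x in u]%fset => x; rewrite ut => /mapP[z zu ->].
  by apply: map_f; rewrite inE.
exists A0 => // A /= /fsubsetP A0A.
set s := [seq val x | x <- enum_fset A].
have sB : [set` s] `<=` B.
  by move=> x /= /mapP[u _ ->]; exact/set_mem/(valP u).
have su : uniq s by rewrite map_inj_uniq ?fset_uniq //; exact: val_inj.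
have -> : summability.partial_sum (fun e : B => ip p (val e) * ip (val e) q) A
    = ip (partial_expansion s p) q.
  rewrite linear_sumlz big_map /summability.partial_sum big_seq_fsetE /=.
  by apply: eq_bigr => i _; rewrite linearZl_LR.
have ts : {subset t <= s}.
  by move=> x /A0t/mapP[u uA0 ->]; apply: map_f; exact: A0A.
rewrite -linearBl (le_lt_trans (norm_ip_le _ _)) //.
(* As [y] is its own expansion, the remainder of [p] is that of [p - y], which is no longer than
   [p - y] itself. *)
have -> : p - partial_expansion s p = (p - y) - partial_expansion s (p - y).
  rewrite partial_expansionB (_ : partial_expansion s y = y).
    by rewrite opprB addrA subrK.
  by rewrite yE (partial_expansion_id Borth).
have := norm_sub_partial_expansion Borth sB su (p - y).
move=> /le_lt_trans/(_ py) ry.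
rewrite (@le_lt_trans _ _ (e / (`|q| + 1) * `|q|)) ?ler_wpM2r ?(ltW ry) //.
by rewrite mulrAC ltr_pdivrMr // ltr_pM2l // ltrDl.
Qed.

(** The term at [e] is [ip q p * (ip p e * ip e q)], so Parseval gives the sum [ip q p * ip p q]. *)
Lemma trace_rank1 (P Q : H -> H) (p q : H) :
  (forall x, P x = ip x p *: p) -> (forall x, Q x = ip x q *: q) ->
  is_trace ip (P \o Q) (`|ip p q| ^+ 2).
Proof.
move=> PE QE B /(@parseval _ p q) pq.
have -> : (fun e : B => ip ((P \o Q) (val e)) (val e)) =
    (fun e : B => ip q p * (ip p (val e) * ip (val e) q)).
  apply/funext => e; rewrite /= QE PE linearZl_LR /= linearZl_LR /=.
  by rewrite -mulrA mulrC -mulrA.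
rewrite (_ : summability.partial_sum _ = (fun A : {fset B} => ip q p *
    summability.partial_sum (fun e : B => ip p (val e) * ip (val e) q) A)).
  by rewrite normCK -ip_conj mulrC; exact: cvgMr.
by apply/funext => A; rewrite /summability.partial_sum mulr_sumr.
Qed.

Lemma trE A t : (exists B, orthonormal_basis ip B) -> is_trace ip A t ->
  tr ip A = t.
Proof.
move=> [B bB] At; apply: xget_subset1 => // u v /(_ _ bB) Bu /(_ _ bB) Bv.
exact: cvg_unique Bu Bv.
Qed.

(* [is_trace] holds vacuously if there is no orthonormal basis, and [tr] is then
   the same arbitrary scalar for all operators. Treating this case apart avoids
   proving that [H] has a basis. *)
Lemma eq_tr_no_basis A A' :
  ~ (exists B, orthonormal_basis ip B) -> tr ip A = tr ip A'.
Proof.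
move=> nB; congr xget.
by apply/seteqP; split=> t _ B bB; case: nB; exists B.
Qed.

(** If [v] spans the range and [P x = c *: v], then symmetry and [P v = v] give
    [c * ip v v = ip x v]; it remains to normalise [v]. *)
Lemma projectiveE (P : projective ip) :
  exists2 p, `|p| = 1 & forall x, P x = ip x p *: p.
Proof.
case: P => P [Plin PP Psym] [v v0 rangeP] /=.
have nv0 : `|v| != 0 by rewrite normr_eq0.
have Pv : P v = v.
  have : range P v by rewrite rangeP; exists 1 => //; rewrite scale1r.
  by move=> [u _ <-]; rewrite -[LHS]/((P \o P) u) PP.
exists (`|v|^-1 *: v); first by rewrite normrZ normfV normr_id mulVf.
move=> x; have [c _ cv] : [set c *: v | c in [set: C]] (P x).
  by rewrite -rangeP; exists x.
have : ip (P x) v = ip x v by rewrite Psym Pv.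
rewrite -cv linearZl_LR /= ip_norm => cE.
rewrite linearZr_LR /= -cE scalerA; congr (_ *: _).
by rewrite fmorphV /= (CrealP _) ?normr_real //; field.
Qed.

End inner_product.

(** Factor the difference of squares: by Cauchy-Schwarz the sum of the two moduli is at most 2 and
    their difference at most the norm of [q - q']. *)
Lemma rank1_transition_lip (C : numClosedFieldType) (H : normedModType C)
    (ip : {dot H for @Num.conj C}) (ip_norm : forall x : H, ip x x = `|x| ^+ 2)
    (p q q' : H) : `|p| = 1 -> `|q| = 1 -> `|q'| = 1 ->
  `| `|ip p q| ^+ 2 - `|ip p q'| ^+ 2| <= 2 * `|q - q'|.
Proof.
move=> p1 q1 q'1; rewrite subr_sqr normrM mulrC ler_pM //.
  rewrite (le_trans (ler_normD _ _)) // !normr_id [2](_ : _ = 1 + 1) //.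
  by rewrite lerD // (le_trans (norm_ip_le ip_norm _ _)) // p1 ?q1 ?q'1 mulr1.
rewrite (le_trans (ler_dist_dist _ _)) // -linearBr.
by rewrite (le_trans (norm_ip_le ip_norm _ _)) // p1 mul1r.
Qed.

(** * Countable approximation of the transition probabilities *)

Section transition_probability.
Context {R : realType} {H : completeNormedModType R[i]}.
Variable ip : {dot H for @Num.conj R[i]}.
Hypothesis ip_norm : forall x : H, ip x x = `|x| ^+ 2.

Definition unit_vector_of (Q : projective ip) (q : H) :=
  `|q| = 1 /\ forall x, Q x = ip x q *: q.

Lemma transition_prob_lip (P Q Q' : projective ip) (q q' : H) :
  unit_vector_of Q q -> unit_vector_of Q' q' ->
  (`|transition_prob Q P - transition_prob Q' P|)%:C%C <= 2 * `|q - q'|.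
Proof.
move=> [q1 QE] [q'1 Q'E]; have [p p1 PE] := projectiveE ip_norm P.
rewrite /transition_prob -raddfB; apply: le_trans (normc_ge_Re _) _.
have [onb|nonb] := pselect (exists B, orthonormal_basis ip B).
  rewrite (trE onb (trace_rank1 ip_norm PE QE)).
  rewrite (trE onb (trace_rank1 ip_norm PE Q'E)).
  exact: rank1_transition_lip.
by rewrite (eq_tr_no_basis _ (P \o Q') nonb) subrr normr0 mulr_ge0.
Qed.

(** Points of [D] need not be unit vectors, so each pair of a point and a radius selects one
    projection having a unit vector that close, if there is any. *)
Lemma transition_prob_separable : separable H ->
  exists2 G : set (projective ip), countable G &
    forall (Q : projective ip) (e : R), 0 < e ->
      exists2 Q', G Q' &
        forall P, `|transition_prob Q P - transition_prob Q' P| < e.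
Proof.
move=> [D cD dD].
have [[Q0 _]|noQ] := pselect (exists Q : projective ip, True); last first.
  by exists set0 => // Q; case: noQ; exists Q.
pose r (k : nat) : R := k.+1%:R^-1.
pose near_ (dk : H * nat) := [set Q : projective ip | exists2 q,
  unit_vector_of Q q & `|q - dk.1| < (r dk.2)%:C%C].
(* [Q0] is the default for pairs with no such projection. *)
exists [set xget Q0 (near_ dk) | dk in D `*` setT].
  by apply: (card_le_trans (card_image_le _ _)); exact: countableX.
move=> Q e e0; have [q q1 QE] := projectiveE ip_norm Q.
have Qq : unit_vector_of Q q by [].
(* Both [q] and [q'] will lie within [r k] of [d]; with Lipschitz constant 2 the error is below
   [2 * (r k + r k) < e]. *)
have [k rk] : exists k, r k < e / 4.
  have [|k] := @ltr_add_invr R 0 (e / 4); first by rewrite divr_gt0.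
  by rewrite add0r; exists k.
have r0 : 0 < (r k)%:C%C :> R[i] by rewrite ltcR invr_gt0.
have [d [qd Dd]] : ball q (r k)%:C%C `&` D !=set0.
  by apply: dD; [exists q; exact: ballxx | exact: ball_open].
have nearQ : near_ (d, k) Q by exists q; last by move: qd; rewrite -ball_normE.
exists (xget Q0 (near_ (d, k))); first by exists (d, k).
have [q' Q'q' q'd] : near_ (d, k) (xget Q0 (near_ (d, k))).
  by apply: xgetPex; exists Q.
have qd' : `|q - d| < (r k)%:C%C by move: qd; rewrite -ball_normE.
move=> P; rewrite -ltcR (le_lt_trans (transition_prob_lip P Qq Q'q')) //.
have : (2 * (r k + r k))%:C%C < e%:C%C :> R[i] by rewrite ltcR; lra.
apply: lt_trans; rewrite rmorphM rmorph_nat rmorphD ltr_pM2l //.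
by rewrite -(subrKA d) (le_lt_trans (ler_normD _ _)) // ltrD // distrC.
Qed.

End transition_probability.

Theorem theorem6 (R : realType) (H : completeNormedModType R[i])
    (ip : {dot H for @Num.conj R[i]})
    (ip_norm : forall x : H, ip x x = `|x| ^+ 2)
    (H_separable : separable H)
    (H_neq0 : exists x : H, x != 0) :
  borel_sigma_algebra ip = transition_sigma_algebra ip.
Proof.
have [G cG dG] := transition_prob_separable ip_norm H_separable.
exact: sigma_algebra_sup_initial_topology cG dG.
Qed.
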